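(* $$\frac{5\pi}{2} = \sum_{k=0}^{\infty}\left(\frac14\right)^{k}\frac{\left(\frac14\right)_k\left(\frac12\right)_k}{\left(\frac98\right)_k\left(\frac{13}{8}\right)_k}\cdot\frac{48k^2+68k+23}{(k+1)(4k+3)}.$$
   Context: For $k\in\mathbb{N}_0$, $(\alpha)_k=\alpha(\alpha+1)\cdots(\alpha+k-1)$ is the rising factorial (Pochhammer symbol), with $(\alpha)_0=1$. *)

(* Defs.v *)
From Stdlib Require Import Reals.
From Coquelicot Require Import Coquelicot.
Open Scope R_scope.

Fixpoint rising_factorial (a : R) (k : nat) : R :=
  match k with
  | O => 1
  | S j => rising_factorial a j * (a + INR j)
  end.

(* Main.v *)
Require Import Defs.
From Stdlib Require Import Reals.
From Coquelicot Require Import Coquelicot.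
From Stdlib Require Import Lra Psatz Lia.
Open Scope R_scope.

(** The series is the boundary [k = 0] of the Wilf-Zeilberger pair
[[
  T(n,k) = (1/4)_{n+k} (1/2)_n / (9/4)_{2n+k},
  F(n,k) = T(n,k) 4 (2n+k+5/4) / (n+k+3/4),
  G(n,k) = T(n,k) (48n^2+68n+23+48nk+32k+16k^2) / ((n+1) (4(n+k)+3)),
]]
    which satisfies [F(n+1,k) - F(n,k) = G(n,k+1) - G(n,k)].  Summing over a square
    trades [sum_n G(n,0)] for [sum_k F(0,k)] up to two sides that tend to [0], and
    [F(0,k) = 10 (1/(4k+1) - 1/(4k+3))] gives ten times Leibniz's series for [PI/4]. *)

Lemma rising_factorial_pos (a : R) (k : nat) : 0 < a -> 0 < rising_factorial a k.
Proof.
  intros Ha. induction k as [|k IH]; simpl; [lra|].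
  apply Rmult_lt_0_compat; [exact IH|]. pose proof (pos_INR k). lra.
Qed.

(** The factors [2a + 2k] and [2a + 2k + 1] are twice [a + k] and twice [a + 1/2 + k]. This is the
    source of the power of [1/4] in the series. *)
Lemma rising_factorial_double (a : R) (k : nat) :
  rising_factorial (2 * a) (2 * k)
  = 4 ^ k * (rising_factorial a k * rising_factorial (a + 1 / 2) k).
Proof.
  induction k as [|k IH]; [simpl; lra|].
  replace (2 * S k)%nat with (S (S (2 * k))) by lia.
  cbn [rising_factorial pow]. rewrite IH, S_INR, mult_INR. simpl (INR 2). field.
Qed.

(** Both sides equal [a (a+1) ... (a+k+1)]. With [a = 1/4] it makes [wz_T 0 k] a rational function
    of [k]. *)
Lemma rising_factorial_shift2 (a : R) (k : nat) :
  rising_factorial a k * ((a + INR k) * (a + 1 + INR k))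
  = a * (a + 1) * rising_factorial (a + 2) k.
Proof.
  induction k as [|k IH]; [simpl; ring|].
  cbn [rising_factorial]. rewrite S_INR.
  transitivity (rising_factorial a k * ((a + INR k) * (a + 1 + INR k)) * (a + 2 + INR k));
    [ring|].
  rewrite IH. ring.
Qed.

Lemma sum_f_R0_const_mul (c : R) (f : nat -> R) (N : nat) :
  sum_f_R0 (fun n => c * f n) N = c * sum_f_R0 f N.
Proof. symmetry. rewrite scal_sum. apply sum_eq. intros; ring. Qed.

(** A discrete Green formula: summing the relation over [n <= N] telescopes [F], and summing the
    result over [k <= K] telescopes the sums of [G]. *)
Lemma wz_rectangle (F G : nat -> nat -> R) (N K : nat) :
  (forall n k, F (S n) k - F n k = G n (S k) - G n k) ->
  sum_f_R0 (fun n => G n O) N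
  = sum_f_R0 (F O) K - sum_f_R0 (F (S N)) K + sum_f_R0 (fun n => G n (S K)) N.
Proof.
  intros H.
  assert (Hcol : forall k, sum_f_R0 (fun n => G n (S k)) N - sum_f_R0 (fun n => G n k) N
                           = F (S N) k - F O k).
  { intros k. rewrite <- minus_sum. induction N as [|N IH]; simpl.
    - now rewrite <- H.
    - rewrite IH, <- H. ring. }
  induction K as [|K IH]; simpl.
  - specialize (Hcol O). lra.
  - specialize (Hcol (S K)). lra.
Qed.

Definition wz_T (n k : nat) : R :=
  rising_factorial (1 / 4) (n + k) * rising_factorial (1 / 2) n
  / rising_factorial (9 / 4) (2 * n + k).

Definition wz_F (n k : nat) : R :=
  wz_T n k * (4 * (2 * INR n + INR k + 5 / 4) / (INR n + INR k + 3 / 4)).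

Definition wz_G (n k : nat) : R :=
  wz_T n k
  * ((48 * INR n ^ 2 + 68 * INR n + 23
      + 48 * INR n * INR k + 32 * INR k + 16 * INR k ^ 2)
     / ((INR n + 1) * (4 * (INR n + INR k) + 3))).

Lemma wz_T_pos (n k : nat) : 0 < wz_T n k.
Proof.
  unfold wz_T. apply Rdiv_lt_0_compat; [apply Rmult_lt_0_compat|];
    apply rising_factorial_pos; lra.
Qed.

Lemma wz_T_succ_l (n k : nat) :
  wz_T (S n) k
  = wz_T n k * ((INR n + INR k + 1 / 4) * (INR n + 1 / 2)
                / ((2 * INR n + INR k + 9 / 4) * (2 * INR n + INR k + 13 / 4))).
Proof.
  unfold wz_T.
  replace (2 * S n + k)%nat with (S (S (2 * n + k))) by lia.
  replace (S n + k)%nat with (S (n + k)) by lia.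
  cbn [rising_factorial].
  rewrite S_INR, !plus_INR, mult_INR. simpl (INR 2).
  pose proof (pos_INR n). pose proof (pos_INR k).
  assert (0 < rising_factorial (9 / 4) (2 * n + k)) by (apply rising_factorial_pos; lra).
  field. repeat split; lra.
Qed.

Lemma wz_T_succ_r (n k : nat) :
  wz_T n (S k)
  = wz_T n k * ((INR n + INR k + 1 / 4) / (2 * INR n + INR k + 9 / 4)).
Proof.
  unfold wz_T.
  replace (2 * n + S k)%nat with (S (2 * n + k)) by lia.
  replace (n + S k)%nat with (S (n + k)) by lia.
  cbn [rising_factorial].
  rewrite !plus_INR, mult_INR. simpl (INR 2).
  pose proof (pos_INR n). pose proof (pos_INR k).
  assert (0 < rising_factorial (9 / 4) (2 * n + k)) by (apply rising_factorial_pos; lra).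
  field. repeat split; lra.
Qed.

(** The two ratio lemmas make [wz_T n k] a common factor; what remains is an identity of rational
    functions in [n] and [k]. *)
Lemma wz_pair (n k : nat) : wz_F (S n) k - wz_F n k = wz_G n (S k) - wz_G n k.
Proof.
  unfold wz_F, wz_G. rewrite wz_T_succ_l, wz_T_succ_r, !S_INR.
  pose proof (pos_INR n). pose proof (pos_INR k).
  field. repeat split; lra.
Qed.

(** Partial fractions of [5 / ((4k+1)(4k+5))], in a form that telescopes when summed over [k]. *)
Lemma wz_T_0 (k : nat) :
  wz_T 0 k = 5 / 4 * / (4 * INR k + 1) - 5 / 4 * / (4 * INR (S k) + 1).
Proof.
  unfold wz_T. cbn [rising_factorial Nat.add Nat.mul].
  pose proof (pos_INR k) as Hk.
  pose proof (rising_factorial_shift2 (1 / 4) k) as E.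
  replace (1 / 4 + 2) with (9 / 4) in E by field.
  assert (0 < rising_factorial (9 / 4) k) by (apply rising_factorial_pos; lra).
  rewrite S_INR.
  replace (rising_factorial (1 / 4) k)
    with (1 / 4 * (1 / 4 + 1) * rising_factorial (9 / 4) k
          / ((1 / 4 + INR k) * (1 / 4 + 1 + INR k)))
    by (rewrite <- E; field; lra).
  field. repeat split; lra.
Qed.

Lemma wz_T_le (n k : nat) : wz_T n k <= (1 / 2) ^ n * wz_T 0 k.
Proof.
  induction n as [|n IH]; [simpl; lra|].
  rewrite wz_T_succ_l. cbn [pow].
  pose proof (pos_INR n). pose proof (pos_INR k). pose proof (wz_T_pos n k).
  apply Rle_trans with (wz_T n k * (1 / 2)); [|lra].
  apply Rmult_le_compat_l; [lra|].
  (* The ratio is at most [1/2]: [n + k + 1/4 <= 2n + k + 9/4] and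
     [n + 1/2 <= (2n + k + 13/4) / 2]. *)
  apply Rle_div_l; nra.
Qed.

Lemma wz_F_pos (n k : nat) : 0 < wz_F n k.
Proof.
  pose proof (pos_INR n). pose proof (pos_INR k).
  apply Rmult_lt_0_compat; [apply wz_T_pos | apply Rdiv_lt_0_compat; lra].
Qed.

Lemma wz_F_le (n k : nat) : wz_F n k <= 8 * (1 / 2) ^ n * wz_T 0 k.
Proof.
  pose proof (pos_INR n). pose proof (pos_INR k).
  pose proof (wz_T_pos n k). pose proof (wz_T_le n k).
  apply Rle_trans with (wz_T n k * 8); [|lra].
  apply Rmult_le_compat_l; [lra|]. apply Rle_div_l; lra.
Qed.

Lemma wz_G_pos (n k : nat) : 0 < wz_G n k.
Proof.
  pose proof (pos_INR n). pose proof (pos_INR k).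
  apply Rmult_lt_0_compat; [apply wz_T_pos | apply Rdiv_lt_0_compat; nra].
Qed.

Lemma wz_G_le (n k : nat) : wz_G n k <= 20 * / (4 * INR k + 1) * (1 / 2) ^ n.
Proof.
  pose proof (pos_INR n). pose proof (pos_INR k).
  pose proof (wz_T_pos n k). pose proof (wz_T_le n k) as HT.
  assert (0 < (1 / 2) ^ n) by (apply pow_lt; lra).
  (* The bound [4 (4k+5)] on the rational factor is chosen so that [4k+5] cancels against the
     denominator of [wz_T 0 k]. *)
  apply Rle_trans with (wz_T n k * (4 * (4 * INR k + 5))).
  - apply Rmult_le_compat_l; [lra|].
    apply Rle_div_l; [nra|].
    assert (0 <= INR n * INR k) by nra.
    assert (0 <= INR n * INR k * INR n) by nra.
    assert (0 <= INR n * INR k * INR k) by nra.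
    nra.
  - apply Rle_trans with ((1 / 2) ^ n * wz_T 0 k * (4 * (4 * INR k + 5))).
    + apply Rmult_le_compat_r; lra.
    + right. rewrite wz_T_0, S_INR. field. lra.
Qed.

(** The sum of [wz_T 0] telescopes to less than [5/4], and [8 * 5/4 = 10]. The bound is uniform in
    [K], so this side vanishes on growing squares. *)
Lemma sum_wz_F_le (n K : nat) : sum_f_R0 (wz_F n) K <= 10 * (1 / 2) ^ n.
Proof.
  assert (0 < (1 / 2) ^ n) by (apply pow_lt; lra).
  apply Rle_trans with (8 * (1 / 2) ^ n * sum_f_R0 (wz_T 0) K).
  - rewrite <- sum_f_R0_const_mul. apply sum_Rle. intros k _. apply wz_F_le.
  - assert (sum_f_R0 (wz_T 0) K = 5 / 4 - 5 / 4 * / (4 * INR (S K) + 1)) as ->.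
    { induction K as [|K IH]; simpl sum_f_R0.
      - rewrite wz_T_0. simpl. field.
      - rewrite IH, wz_T_0. ring. }
    assert (0 < / (4 * INR (S K) + 1)).
    { apply Rinv_0_lt_compat. pose proof (pos_INR (S K)). lra. }
    nra.
Qed.

Lemma sum_wz_G_le (N k : nat) :
  sum_f_R0 (fun n => wz_G n k) N <= 40 * / (4 * INR k + 1).
Proof.
  assert (0 < / (4 * INR k + 1)).
  { apply Rinv_0_lt_compat. pose proof (pos_INR k). lra. }
  apply Rle_trans with (20 * / (4 * INR k + 1) * sum_f_R0 (pow (1 / 2)) N).
  - rewrite <- sum_f_R0_const_mul. apply sum_Rle. intros n _. apply wz_G_le.
  - rewrite tech3 by lra.
    assert (0 < (1 / 2) ^ S N) by (apply pow_lt; lra).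
    replace ((1 - (1 / 2) ^ S N) / (1 - 1 / 2)) with (2 - 2 * (1 / 2) ^ S N) by field.
    nra.
Qed.

(** Each [wz_F 0 k] is ten times a pair of consecutive Leibniz terms, so [k <= K] covers the indices
    [0] to [2K+1]. *)
Lemma sum_wz_F_0 (K : nat) :
  sum_f_R0 (wz_F 0) K = 10 * sum_f_R0 (tg_alt PI_tg) (S (2 * K)).
Proof.
  assert (Hodd : forall k, wz_F 0 k
            = 10 * (tg_alt PI_tg (2 * k) + tg_alt PI_tg (S (2 * k)))).
  { intros k. unfold wz_F, tg_alt, PI_tg.
    rewrite pow_1_odd, pow_1_even, wz_T_0.
    rewrite !plus_INR, !mult_INR, !S_INR, ?mult_INR. simpl.
    pose proof (pos_INR k). field. repeat split; lra. }
  induction K as [|K IH].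
  - simpl sum_f_R0. rewrite Hodd. reflexivity.
  - rewrite tech5, IH, Hodd.
    replace (S (2 * S K)) with (S (S (S (2 * K)))) by lia.
    replace (2 * S K)%nat with (S (S (2 * K))) by lia.
    rewrite !(tech5 _ (S _)). ring.
Qed.

(** The Leibniz partial sums up to [2K+1] and [2K] enclose [PI/4] and differ by [1/(4K+3)]. *)
Lemma sum_wz_F_0_bounds (K : nat) :
  5 * PI / 2 - 10 * / (4 * INR K + 3) <= sum_f_R0 (wz_F 0) K <= 5 * PI / 2.
Proof.
  pose proof (PI_ineq K) as [H1 H2].
  rewrite sum_wz_F_0. rewrite tech5 in *.
  replace (tg_alt PI_tg (S (2 * K))) with (- / (4 * INR K + 3)) in *; [lra|].
  unfold tg_alt, PI_tg. rewrite pow_1_odd.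
  rewrite plus_INR, mult_INR, !S_INR, mult_INR. simpl.
  pose proof (pos_INR K). field. lra.
Qed.

Lemma wz_G_0_r (k : nat) :
  wz_G k 0
  = (1 / 4) ^ k
    * ((rising_factorial (1 / 4) k * rising_factorial (1 / 2) k)
       / (rising_factorial (9 / 8) k * rising_factorial (13 / 8) k))
    * ((48 * INR k ^ 2 + 68 * INR k + 23)
       / ((INR k + 1) * (4 * INR k + 3))).
Proof.
  unfold wz_G, wz_T. rewrite !Nat.add_0_r.
  (* Duplication turns [(9/4)_{2k}] into [4^k (9/8)_k (13/8)_k]. *)
  replace (9 / 4) with (2 * (9 / 8)) by field.
  rewrite rising_factorial_double.
  replace (9 / 8 + 1 / 2) with (13 / 8) by field.
  replace ((1 / 4) ^ k) with (/ 4 ^ k) by (rewrite <- pow_inv; f_equal; field).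
  assert (0 < rising_factorial (9 / 8) k) by (apply rising_factorial_pos; lra).
  assert (0 < rising_factorial (13 / 8) k) by (apply rising_factorial_pos; lra).
  assert (0 < 4 ^ k) by (apply pow_lt; lra).
  pose proof (pos_INR k). simpl (INR 0).
  field. repeat split; lra.
Qed.

Lemma is_lim_seq_inv_affine (a b c : R) :
  0 < a -> is_lim_seq (fun N => c * / (a * INR N + b)) 0.
Proof.
  intros Ha.
  replace (Finite 0) with (Rbar_mult c (Rbar_inv p_infty)) by (simpl; now rewrite Rmult_0_r).
  apply is_lim_seq_scal_l, is_lim_seq_inv; [|discriminate].
  apply is_lim_seq_plus with p_infty b; [|apply is_lim_seq_const|reflexivity].
  replace p_infty with (Rbar_mult a p_infty).
  - apply is_lim_seq_scal_l, is_lim_seq_INR.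
  - apply is_Rbar_mult_unique, is_Rbar_mult_sym, is_Rbar_mult_p_infty_pos. exact Ha.
Qed.

Theorem mainTheorem16 :
  is_series
    (fun k : nat =>
       (1 / 4) ^ k
       * ((rising_factorial (1 / 4) k * rising_factorial (1 / 2) k)
          / (rising_factorial (9 / 8) k * rising_factorial (13 / 8) k))
       * ((48 * INR k ^ 2 + 68 * INR k + 23)
          / ((INR k + 1) * (4 * INR k + 3))))
    (5 * PI / 2).
Proof.
  apply is_series_ext with (fun k => wz_G k 0); [exact wz_G_0_r|].
  change (is_lim_seq (sum_n (fun k => wz_G k 0)) (5 * PI / 2)).
  apply is_lim_seq_ext with (sum_f_R0 (fun k => wz_G k 0));
    [intros N; symmetry; apply sum_n_Reals|].
  (* Squeeze on the square [K = N]: the lower bound drops the nonnegative [G] side at [k = N+1], the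
     upper bound drops the [F] side at [n = N+1], which enters with a minus sign. *)
  apply is_lim_seq_le_le with
    (u := fun N => 5 * PI / 2 - 10 * / (4 * INR N + 3) - 10 * (1 / 2) ^ S N)
    (w := fun N => 5 * PI / 2 + 40 * / (4 * INR N + 5)).
  - intros N. rewrite (wz_rectangle wz_F wz_G N N wz_pair).
    pose proof (sum_wz_F_0_bounds N).
    pose proof (sum_wz_F_le (S N) N).
    assert (0 <= sum_f_R0 (wz_F (S N)) N).
    { apply cond_pos_sum. intros k. left. apply wz_F_pos. }
    assert (0 <= sum_f_R0 (fun n => wz_G n (S N)) N).
    { apply cond_pos_sum. intros n. left. apply wz_G_pos. }
    pose proof (sum_wz_G_le N (S N)) as HG. rewrite S_INR in HG.
    replace (4 * (INR N + 1) + 1) with (4 * INR N + 5) in HG by ring.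
    lra.
  - replace (Finite (5 * PI / 2)) with (Finite (5 * PI / 2 - 0 - 10 * 0))
      by (f_equal; ring).
    apply is_lim_seq_minus'; [apply is_lim_seq_minus'|].
    + apply is_lim_seq_const.
    + apply is_lim_seq_inv_affine. lra.
    + apply (is_lim_seq_scal_l (fun N => (1 / 2) ^ S N) 10 0).
      apply (is_lim_seq_incr_1 (pow (1 / 2))).
      apply is_lim_seq_geom. rewrite Rabs_pos_eq; lra.
  - replace (Finite (5 * PI / 2)) with (Finite (5 * PI / 2 + 0)) by (f_equal; ring).
    apply is_lim_seq_plus'; [apply is_lim_seq_const|].
    apply is_lim_seq_inv_affine. lra.
Qed.
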